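(* Let $D=(V,E)$ be a strongly connected directed graph (multiple edges allowed) with a fixed cyclic ordering of the out-edges at each vertex, and let $(w,\varrho)$ be a unicycle on $D$. If we iterate the rotor-router operation starting from $(w,\varrho)$ until we first arrive back at $(w,\varrho)$, then each vertex $v$ is reached ${\rm per}_D(v)\, d^+(v)$ times by the chip. Therefore the rotor at each vertex $v$ makes exactly ${\rm per}_D(v)$ full turns, each edge $(u,v)$ is traversed ${\rm per}_D(u)$ times (counted with multiplicity for each parallel edge), and the length of the period is $\sum_{v\in V}{\rm per}_D(v)\, d^+(v)$.
   Context: $d^+(v)$ and $d^-(v)$ denote out- and in-degree. At each vertex $v$ a cyclic ordering of the outgoing edges is fixed; for an edge $e$ with tail $v$, $e^+$ denotes the edge following $e$ in this cyclic order. A rotor configuration $\varrho$ assigns to each vertex $v$ an out-edge $\varrho(v)$ with tail $v$. A chip-and-rotor configuration is a pair $(w,\varrho)$ with $w\in V$ (a chip placed on $w$) and $\varrho$ a rotor configuration. The rotor-router operation sends $(w,\varrho)$ to $(w^+,\varrho^+)$, where $\varrho^+(v)=\varrho(v)$ for $v\neq w$, $\varrho^+(w)=\varrho(w)^+$, and $w^+$ is the head of $\varrho^+(w)$. A unicycle is a chip-and-rotor configuration $(w,\varrho)$ such that the edge set $\{\varrho(v):v\in V\}$ contains a unique directed cycle and $w$ lies on this cycle. Identify $V$ with $\{1,\dots,n\}$. The Laplacian $L_D$ is the $n\times n$ matrix with $L_D(i,i)=-d^+(i)$ and $L_D(i,j)=d(j,i)$ for $i\neq j$, where $d(j,i)$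 is the number of edges from $j$ to $i$. Since $D$ is strongly connected, $\ker L_D$ is one-dimensional; the period vector ${\rm per}_D$ is the unique vector $x\in\mathbb{Z}^n$ with $L_Dx=0$ whose entries are positive and have no nontrivial common divisor. ${\rm per}_D(v)$ denotes its $v$-coordinate. *)

(* Defs.v *)
From mathcomp Require Import all_boot all_order all_algebra all_fingroup.

Set Implicit Arguments.
Unset Strict Implicit.
Unset Printing Implicit Defensive.

Import Order.TTheory GRing.Theory Num.Theory.
Local Open Scope ring_scope.

(* Edges form a type of their own, so parallel edges are allowed.  Loops are
   excluded: a diagonal entry -d^+(i) of the Laplacian is only right without
   them (with a loop, the columns of [laplacian] would not sum to 0). *)
Record digraph (n : nat) := Digraph {
  edge : finType;
  etail : edge -> 'I_n;
  ehead : edge -> 'I_n;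
  loopless : forall e, etail e != ehead e
}.

(* Cyclic orderings of the out-edges of all the vertices, encoded as a single
   permutation [nxt] (e |-> e^+) whose cycles are exactly the sets of edges
   with a common tail. *)
Record rotor_order (n : nat) (D : digraph n) := RotorOrder {
  nxt : {perm edge D};
  nxt_cycle : forall e f, (f \in porbit nxt e) = (etail f == etail e)
}.

Section Digraph.

Variables (n : nat) (D : digraph n).
Implicit Types (u v : 'I_n) (e f : edge D).

Definition adjacent : rel 'I_n :=
  fun u v => [exists e : edge D, (etail e == u) && (ehead e == v)].

Definition strongly_connected : bool :=
  (0 < n)%N && [forall u, forall v, connect adjacent u v].

Definition outdeg v : nat := #|[set e : edge D | etail e == v]|.

Definition mult u v : nat :=
  #|[set e : edge D | (etail e == u) && (ehead e == v)]|.

Definition laplacian : 'M[int]_n :=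
  \matrix_(i, j) if i == j then - (outdeg i)%:Z else (mult j i)%:Z.

Definition is_period_vector (x : 'cV[int]_n) : bool :=
  [&& laplacian *m x == 0,
      [forall i, 0 < x i 0]
    & \big[gcdn/0%N]_(i < n) absz (x i 0) == 1%N].

Lemma is_period_vectorP (x : 'cV[int]_n) :
  reflect [/\ laplacian *m x = 0,
              forall i, 0 < x i 0
            & forall d : nat, (forall i, (d %| (x i 0)%R)%Z) -> d = 1%N]
          (is_period_vector x).
Proof.
apply: (iffP and3P) => [[/eqP Lx /forallP x_gt0 /eqP gx]|[Lx x_gt0 gx]].
  split=> // d dx; apply/eqP; rewrite -dvdn1 -gx.
  by apply/dvdn_biggcdP => i _; have := dx i; rewrite dvdzE.
split; [exact/eqP|exact/forallP|apply/eqP/gx => i].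
by rewrite dvdzE /= (@biggcdn_inf _ i).
Qed.

Lemma mult_diag v : mult v v = 0%N.
Proof.
apply/eqP; rewrite cards_eq0; apply/eqP/setP => e; rewrite !inE.
by apply/negP => /andP[/eqP te /eqP he]; move: (loopless e); rewrite te he eqxx.
Qed.

Lemma sum_mult u : (\sum_v mult u v)%N = outdeg u.
Proof.
rewrite /outdeg -sum1_card (partition_big (@ehead _ D) predT) //=.
apply: eq_bigr => v _; rewrite /mult -sum1_card.
by apply: eq_bigl => e; rewrite !inE.
Qed.

Lemma sum_multz u : \sum_v (mult u v)%:Z = (outdeg u)%:Z.
Proof.
by rewrite -sum_mult -natz natr_sum; apply: eq_bigr => v _; rewrite natz.
Qed.

Lemma laplacianE (x : 'cV[int]_n) i :
  (laplacian *m x) i 0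
    = \sum_j (mult j i)%:Z * x j 0 - (outdeg i)%:Z * x i 0.
Proof.
rewrite mxE (bigD1 i) //= [in RHS](bigD1 i) //= mult_diag mul0r add0r addrC.
rewrite mxE eqxx mulNr; congr (_ - _); apply: eq_bigr => j ji.
by rewrite mxE eq_sym (negbTE ji).
Qed.

Lemma laplacian_kerP (x : 'cV[int]_n) :
  laplacian *m x = 0 <->
  forall i, (outdeg i)%:Z * x i 0 = \sum_j (mult j i)%:Z * x j 0.
Proof.
split=> [Lx i|h].
  by apply/esym/eqP; rewrite -subr_eq0 -laplacianE Lx mxE.
by apply/matrixP => i j; rewrite (ord1 j) laplacianE h subrr mxE.
Qed.

Lemma laplacian_ker_norm (x : 'cV[int]_n) :
  laplacian *m x = 0 -> laplacian *m map_mx Num.norm x = 0.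
Proof.
move=> /laplacian_kerP h; apply/laplacian_kerP.
pose F i := (outdeg i)%:Z * `|x i 0|.
pose G i := \sum_j (mult j i)%:Z * `|x j 0|.
have leFG i : F i <= G i.
  rewrite /F -[(outdeg i)%:Z]ger0_norm // -normrM h.
  apply: le_trans (ler_norm_sum _ _ _) _; apply: ler_sum => j _.
  by rewrite normrM [`|(mult j i)%:Z|]ger0_norm.
have sumFG : \sum_i (G i - F i) = 0.
  rewrite sumrB /G exchange_big /=; apply/eqP; rewrite subr_eq0; apply/eqP.
  apply: eq_bigr => i _; by rewrite -mulr_suml sum_multz.
move=> i; rewrite mxE; under [RHS]eq_bigr do rewrite mxE.
apply/esym/eqP; rewrite -subr_eq0; move/eqP: sumFG.
rewrite psumr_eq0 => [/allP/(_ i)|j _]; last by rewrite subr_ge0.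
by rewrite mem_index_enum => /(_ isT).
Qed.

Lemma laplacian_ker_pos (x : 'cV[int]_n) i :
  strongly_connected -> laplacian *m x = 0 -> x i 0 = 0 -> x = 0.
Proof.
move=> /andP[_ /forallP conn] /laplacian_ker_norm/laplacian_kerP h xi0.
have step u v : adjacent u v -> x v 0 = 0 -> x u 0 = 0.
  move=> /existsP[e /andP[te he]] xv0; have := h v; rewrite mxE xv0 normr0 mulr0.
  move/esym/eqP; rewrite psumr_eq0 => [/allP/(_ u)|j _]; last first.
    by rewrite mxE mulr_ge0.
  rewrite mem_index_enum mxE => /(_ isT) /=.
  rewrite mulf_eq0 normr_eq0 => /orP[|/eqP //].
  rewrite eqz_nat cards_eq0 => /eqP/setP/(_ e).
  by rewrite !inE te he.
apply/matrixP => u j; rewrite (ord1 j) [RHS]mxE.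
have /forallP/(_ i)/connectP[p] := conn u.
elim: p u => [u _ /= <- //|v p IH u /= /andP[uv pv] lp].
exact: step uv (IH _ pv lp).
Qed.

Lemma det_laplacian : strongly_connected -> \det laplacian == 0.
Proof.
move=> /andP[n0 _]; apply/det0P; exists (const_mx 1).
  apply/eqP => /matrixP/(_ 0 (Ordinal n0)); rewrite !mxE => /eqP.
  by rewrite oner_eq0.
apply/matrixP => i j; rewrite mxE [RHS]mxE.
under eq_bigr do rewrite !mxE mul1r.
rewrite (bigD1 j) //= eqxx -sum_multz (bigD1 j) //= mult_diag add0r addrC.
apply/eqP; rewrite subr_eq0; apply/eqP/eq_bigr => k kj.
by rewrite (negbTE kj).
Qed.

Lemma period_vector_exists :
  strongly_connected -> exists x, is_period_vector x.
Proof.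
move=> sc; have n0 : (0 < n)%N by case/andP: sc.
have [y y0 Ly] : exists2 y : 'cV[int]_n, y != 0 & laplacian *m y = 0.
  have := det_laplacian sc; rewrite -det_tr => /det0P[v v0 vL].
  exists v^T; first by rewrite -(inj_eq trmx_inj) trmxK trmx0.
  by apply: trmx_inj; rewrite trmx_mul trmxK vL trmx0.
have y_neq0 i : y i 0 != 0.
  by apply: contraNneq y0 => /(laplacian_ker_pos sc Ly) ->.
have /laplacian_kerP Lny := laplacian_ker_norm Ly.
pose g := (\big[gcdn/0%N]_(i < n) absz (y i 0)).
have g_dvd i : (g %| absz (y i 0)%R)%N by rewrite /g (@biggcdn_inf _ i).
have g_gt0 : (0 < g)%N.
  rewrite lt0n; apply: contraNneq (y_neq0 (Ordinal n0)) => g0.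
  by have := g_dvd (Ordinal n0); rewrite g0 dvd0n absz_eq0.
pose x : 'cV[int]_n := \col_i (absz (y i 0)%R %/ g)%N%:Z.
have xE i : x i 0 * g%:Z = `|y i 0|.
  by rewrite mxE -PoszM divnK // abszE.
have gz : g%:Z != 0 by rewrite eqz_nat -lt0n.
exists x; apply/is_period_vectorP; split.
- apply/laplacian_kerP => i; apply: (mulIf gz).
  rewrite -mulrA xE mulr_suml; have := Lny i; rewrite mxE => ->.
  by apply: eq_bigr => j _; rewrite -mulrA xE mxE.
- move=> i; rewrite mxE ltz_nat divn_gt0 //.
  by apply: dvdn_leq => //; rewrite absz_gt0.
move=> d dx; apply/eqP; rewrite -dvdn1 -(dvdn_pmul2r g_gt0) mul1n.
rewrite {2}/g; apply/dvdn_biggcdP => i _.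
have := dx i; rewrite dvdzE mxE /= => dxi.
by rewrite -(divnK (g_dvd i)) dvdn_pmul2r.
Qed.

Definition period_vector (sc : strongly_connected) : 'cV[int]_n :=
  xchoose (period_vector_exists sc).

Lemma period_vector_unique (sc : strongly_connected) x :
  is_period_vector x = (x == period_vector sc).
Proof.
apply/idP/eqP => [px|->]; last exact: xchooseP.
have /is_period_vectorP[Ly y0 gy] := xchooseP (period_vector_exists sc).
rewrite -/(period_vector sc) in Ly y0 gy; set y := period_vector sc in Ly y0 gy *.
have /is_period_vectorP[Lx x0 gx] := px.
have n0 : (0 < n)%N by case/andP: (sc).
pose o := Ordinal n0.
have xy i : y o 0 * x i 0 = x o 0 * y i 0.
  have z0 : y o 0 *: x - x o 0 *: y = 0.
    apply: (@laplacian_ker_pos _ o) => //.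
      by rewrite mulmxBr -!scalemxAr Lx Ly !scaler0 subrr.
    by rewrite !mxE mulrC subrr.
  by move/matrixP/(_ i 0): z0; rewrite !mxE => /eqP; rewrite subr_eq0 => /eqP.
have gcd1 (z : 'cV[int]_n) :
    (forall d : nat, (forall i, (d %| (z i 0)%R)%Z) -> d = 1%N) ->
    (\big[gcdn/0%N]_(i < n) absz (z i 0)) = 1%N.
  by move=> h; apply: h => i; rewrite dvdzE /= (@biggcdn_inf _ i).
have key (a b : 'cV[int]_n) :
    (forall i, b o 0 * a i 0 = a o 0 * b i 0) ->
    (forall d : nat, (forall i, (d %| (a i 0)%R)%Z) -> d = 1%N) ->
    (absz (a o 0)%R %| absz (b o 0)%R)%N.
  move=> ab ga.
  have -> : absz (b o 0) =
      (absz (b o 0)%R * \big[gcdn/0]_(i < n) absz (a i 0)%R)%N.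
    by rewrite gcd1 ?muln1.
  rewrite (@big_morph _ _ (fun m => absz (b o 0)%R * m)%N 0%N gcdn) //; last first.
  - exact: muln0.
  - by move=> p q; rewrite muln_gcdr.
  by apply/dvdn_biggcdP => i _; rewrite -abszM ab abszM dvdn_mulr.
have eo : x o 0 = y o 0.
  have /eqP e : absz (x o 0) == absz (y o 0) by rewrite eqn_dvd !key.
  by rewrite -(gtz0_abs (x0 o)) -(gtz0_abs (y0 o)) e.
apply/matrixP => i j; rewrite (ord1 j); apply: (@mulfI _ (y o 0)).
  by rewrite gt_eqF.
by rewrite xy eo.
Qed.

Definition per (sc : strongly_connected) v : nat := absz (period_vector sc v 0).

Lemma perE (sc : strongly_connected) v :
  (per sc v)%:Z = period_vector sc v 0.
Proof.
rewrite /per gtz0_abs //.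
have : is_period_vector (period_vector sc) by rewrite period_vector_unique.
by case/is_period_vectorP.
Qed.

Definition rotor_config (rho : {ffun 'I_n -> edge D}) : Prop :=
  forall v, etail (rho v) = v.

(* A directed cycle, as an edge set; [uniq] makes it a simple one. *)
Definition dicycle (C : {set edge D}) : Prop :=
  exists s : seq (edge D),
    [/\ s != [::], path.cycle (fun e f => ehead e == etail f) s,
        uniq (map (@etail _ D) s) & C = [set e in s]].

Definition chip_config : Type := ('I_n * {ffun 'I_n -> edge D})%type.

Definition unicycle (c : chip_config) : Prop :=
  rotor_config c.2 /\
  exists2 C : {set edge D},
    unique (fun C => dicycle C /\ C \subset [set c.2 v | v : 'I_n]) C
    & c.1 \in [set etail e | e in C].

Variable O : rotor_order D.

Definition rotor_step (c : chip_config) : chip_config :=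
  let rho' := [ffun v => if v == c.1 then nxt O (c.2 v) else c.2 v] in
  (ehead (rho' c.1), rho').

Variable c : chip_config.

Definition chip_at (t : nat) : 'I_n := (iter t rotor_step c).1.

Definition rotor_at (t : nat) (v : 'I_n) : edge D := (iter t rotor_step c).2 v.

(* Step t (from time t to time t + 1) moves the chip along the edge that the
   rotor at its current vertex points to after having been advanced. *)
Definition edge_at (t : nat) : edge D := rotor_at t.+1 (chip_at t).

Definition first_return (T : nat) : Prop :=
  [/\ (0 < T)%N, iter T rotor_step c = c
    & forall t, (0 < t < T)%N -> iter t rotor_step c <> c].

(* The chip reaches a vertex when it moves onto it: times 1, ..., T. *)
Definition reach_count (T : nat) (v : 'I_n) : nat :=
  #|[set t : 'I_T | chip_at t.+1 == v]|.

Definition traverse_count (T : nat) (e : edge D) : nat :=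
  #|[set t : 'I_T | edge_at t == e]|.

(* The successive positions taken by the rotor at v during the first T steps;
   it is advanced exactly at the steps that start with the chip at v. *)
Definition rotor_log (T : nat) (v : 'I_n) : seq (edge D) :=
  [seq rotor_at t.+1 v | t <- iota 0 T & chip_at t == v].

(* One full turn goes once through all the out-edges of v in cyclic order,
   from the successor of the initial rotor back to the initial rotor. *)
Definition full_turn (v : 'I_n) : seq (edge D) :=
  traject (nxt O) (nxt O (rotor_at 0 v)) (outdeg v).

Definition full_turns (T : nat) (v : 'I_n) (k : nat) : Prop :=
  rotor_log T v = flatten (nseq k (full_turn v)).

End Digraph.

(* Main.v *)
Require Import Defs.
From mathcomp Require Import all_boot all_order all_algebra all_fingroup.

(* Write d(v) for the out-degree and stop the walk when the chip is about to
   leave some v for the (per(v) d(v) + 1)-st time.  Until then each edge with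
   tail u is traversed at most per(u) times, so by L per = 0 the chip has
   entered v at most per(v) d(v) times; as it has left v that often and is there
   again, v is the starting vertex and every in-edge (u, v) has been traversed
   the full per(u) times.  In a unicycle the rotors lead from every vertex to
   the starting one, so this saturation spreads backwards along them to the
   whole graph, and the walk is back at its initial state.  Conversely, any
   return makes k(v) full turns at each v for a vector k in ker L, hence a
   positive multiple of per, so no earlier return exists. *)

Set Implicit Arguments.
Unset Strict Implicit.
Unset Printing Implicit Defensive.

Import GRing.Theory.

(** * Trajectories and periods of a permutation *)

Lemma traject_add (T : Type) (f : T -> T) x m k :
  traject f x (m + k) = traject f x m ++ traject f (iter m f x) k.
Proof. by elim: m x => //= m IH x; rewrite IH -iterSr. Qed.

Lemma iter_mul_id (T : Type) (f : T -> T) x d q :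
  iter d f x = x -> iter (q * d) f x = x.
Proof. by move=> fx; elim: q => //= q IH; rewrite mulSn iterD IH. Qed.

Lemma traject_mul (T : Type) (f : T -> T) x d q :
  iter d f x = x -> traject f x (q * d) = flatten (nseq q (traject f x d)).
Proof.
by move=> fx; elim: q => //= q IH; rewrite mulSn traject_add fx IH.
Qed.

Lemma count_iota (T : nat) (P : pred nat) :
  count P (iota 0 T) = #|[set t : 'I_T | P t]|.
Proof.
have -> : iota 0 T = index_iota 0 T by rewrite /index_iota subn0.
rewrite -sum1_count -sum1_card big_mkord.
by apply: eq_bigl => t; rewrite inE.
Qed.

Section PermTraject.

Variables (T : finType) (s : {perm T}) (x : T).
Local Notation d := #|porbit s x|.

(** The trajectory starts at [s x] because a rotor is advanced before the chip follows it; [q] turns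
    then meet each element of the cycle once per turn. *)
Lemma count_traject_mul q y :
  y \in porbit s x -> count_mem y (traject s (s x) (q * d)) = q.
Proof.
rewrite -(porbit_perm s 1) expg1 => yx.
rewrite traject_mul ?iter_porbit // count_flatten map_nseq sumn_nseq.
by rewrite count_uniq_mem ?uniq_traject_porbit // -porbit_traject yx mul1n.
Qed.

Lemma iter_porbit_dvd m : iter m s x = x -> d %| m.
Proof.
have d_gt0 : 0 < d by rewrite lt0n card_porbit_neq0.
rewrite {1}(divn_eq m d) addnC iterD iter_mul_id ?iter_porbit // => xm.
have lt_md : m %% d < d by rewrite ltn_pmod.
have := nth_uniq x _ _ (uniq_traject_porbit s x).
move/(_ (m %% d) 0); rewrite size_traject => /(_ lt_md d_gt0).
by rewrite !nth_traject //= xm eqxx => /esym.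
Qed.

End PermTraject.

(** * Nonnegative integer vectors in the kernel of the Laplacian *)

Section Balance.

Variables (n : nat) (D : digraph n).

(** Flow conservation when each edge leaving [u] carries [k u]. Summing over edges instead of
    neighbours matches the traversal counts. *)
Definition balanced (k : 'I_n -> nat) : Prop :=
  forall v, k v * outdeg D v = \sum_(e : edge D | ehead e == v) k (etail e).

Lemma balanced_laplacian k :
  balanced k <-> (laplacian D *m \col_i (k i)%:Z = 0)%R.
Proof.
have sumE v : (\sum_j (mult D j v)%:Z * (\col_i (k i)%:Z) j 0)%R
    = (\sum_(e : edge D | ehead e == v) k (etail e))%N%:Z%R.
  under [LHS]eq_bigr do rewrite mxE.
  rewrite (partition_big (@etail _ D) predT) //= -natz natr_sum.
  apply: eq_bigr => j _; rewrite natz -PoszM; congr Posz.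
  rewrite (eq_bigr (fun=> k j)) => [|e /andP[_ /eqP-> //]].
  rewrite sum_nat_const; congr (_ * _); rewrite /mult.
  rewrite -sum1_card -[RHS]sum1_card.
  by apply: eq_bigl => e; rewrite inE andbC.
split=> [h|/laplacian_kerP h].
  by apply/laplacian_kerP => v; rewrite sumE mxE -h -PoszM mulnC.
by move=> v; have := h v; rewrite sumE mxE -PoszM mulnC => -[].
Qed.

Hypothesis sc : strongly_connected D.

Lemma period_vectorE : period_vector sc = (\col_i (per sc i)%:Z)%R.
Proof. by apply/colP => i; rewrite mxE perE. Qed.

Lemma period_vectorP : is_period_vector D (period_vector sc).
Proof. by rewrite period_vector_unique. Qed.

Lemma per_balanced : balanced (per sc).
Proof.
apply/balanced_laplacian; rewrite -period_vectorE.
by case/is_period_vectorP: period_vectorP.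
Qed.

Lemma per_gt0 v : 0 < per sc v.
Proof.
by rewrite -ltz_nat perE; case/is_period_vectorP: period_vectorP.
Qed.

(** No coordinate of a nonzero kernel vector vanishes, so [k] is positive and proportional to
    [per sc]. As the entries of [per sc] are coprime, [per sc v] divides [k v]. *)
Lemma per_le_balanced k u :
  balanced k -> 0 < k u -> forall v, per sc v <= k v.
Proof.
move=> /balanced_laplacian Lk ku v.
have k_gt0 : 0 < k v.
  rewrite lt0n; apply: contraTneq ku => kv.
  have /(laplacian_ker_pos sc Lk)/matrixP/(_ u 0%R) :
    ((\col_i (k i)%:Z) v 0 = 0)%R by rewrite mxE kv.
  by rewrite !mxE => -[->].
have /is_period_vectorP[Lp _ gp] := period_vectorP.
have prop i : per sc v * k i = k v * per sc i.
  (* The coefficients make this kernel vector vanish at [v], hence everywhere. *)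
  have z0 : ((per sc v)%:Z *: (\col_i (k i)%:Z)
             - (k v)%:Z *: period_vector sc = 0)%R.
    apply: (@laplacian_ker_pos _ D _ v) => //.
      by rewrite mulmxBr -!scalemxAr Lk Lp !scaler0 subrr.
    by rewrite !mxE -perE mulrC subrr.
  move/matrixP/(_ i 0%R): z0; rewrite !mxE -perE => /eqP.
  by rewrite subr_eq0 => /eqP; rewrite -!PoszM => -[].
apply: dvdn_leq => //.
have per_gcd : \big[gcdn/0]_(i < n) per sc i = 1.
  by apply: gp => i; rewrite dvdzE /= (@biggcdn_inf _ i).
rewrite -(muln1 (k v)) -per_gcd.
rewrite (@big_morph _ _ (fun m => k v * m) 0 gcdn) ?muln0 //; last first.
  by move=> p q; rewrite muln_gcdr.
by apply/dvdn_biggcdP => i _; rewrite -prop dvdn_mulr.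
Qed.

End Balance.

(** * Departures, arrivals and traversals along the walk *)

Section RotorWalk.

Variables (n : nat) (D : digraph n) (O : rotor_order D) (c : chip_config D).
Hypothesis rho_ok : rotor_config c.2.

Local Notation chip := (chip_at O c).
Local Notation rho := (c.2).

Lemma mem_porbit_rotor e v : (e \in porbit (nxt O) (rho v)) = (etail e == v).
Proof. by rewrite nxt_cycle rho_ok. Qed.

Lemma card_porbit_rotor v : #|porbit (nxt O) (rho v)| = outdeg D v.
Proof.
rewrite -sum1_card /outdeg -[RHS]sum1_card.
by apply: eq_bigl => e; rewrite mem_porbit_rotor inE.
Qed.

Lemma outdeg_gt0 v : 0 < outdeg D v.
Proof. by rewrite -card_porbit_rotor lt0n card_porbit_neq0. Qed.

(** Departures from [v], at times 0 to t - 1, whereas [reach_count] counts arrivals, at times 1 to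
    t. Each departure advances the rotor at [v] once. *)
Definition visits t v : nat := count (fun s => chip s == v) (iota 0 t).

Lemma visitsS t v : visits t.+1 v = visits t v + (chip t == v).
Proof. by rewrite /visits -addn1 iotaD count_cat /= addn0. Qed.

Lemma sum_visits t : \sum_v visits t v = t.
Proof.
elim: t => [|t IH]; first by rewrite big1.
under eq_bigr do rewrite visitsS.
rewrite big_split /= IH (bigD1 (chip t)) //= eqxx big1 ?addn0 ?addn1 // => v.
by rewrite eq_sym => /negbTE->.
Qed.

Lemma rotor_atS t v :
  rotor_at O c t.+1 v =
  if v == chip t then nxt O (rotor_at O c t v) else rotor_at O c t v.
Proof. by rewrite /rotor_at /= ffunE. Qed.

Lemma rotor_atE t v : rotor_at O c t v = iter (visits t v) (nxt O) (rho v).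
Proof.
elim: t => // t IH; rewrite rotor_atS visitsS IH [v == _]eq_sym.
by case: eqP; rewrite ?addn1 ?addn0.
Qed.

Lemma chip_atS t : chip t.+1 = ehead (edge_at O c t).
Proof. by rewrite /edge_at /rotor_at. Qed.

Lemma etail_rotor_at t v : etail (rotor_at O c t v) = v.
Proof.
apply/eqP; rewrite -mem_porbit_rotor rotor_atE -permX.
exact: mem_porbit.
Qed.

Lemma rotor_logE t v :
  rotor_log O c t v = traject (nxt O) (nxt O (rho v)) (visits t v).
Proof.
elim: t => // t IH.
rewrite /rotor_log -addn1 iotaD filter_cat map_cat [map _ _]IH addn1 visitsS /=.
have [<-|_] := eqVneq (chip t) v; last by rewrite addn0 cats0.
by rewrite addn1 trajectSr -cats1 -iterSr /= rotor_atS eqxx rotor_atE.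
Qed.

Lemma traverse_countE t e :
  traverse_count O c t e =
  count_mem e (traject (nxt O) (nxt O (rho (etail e))) (visits t (etail e))).
Proof.
rewrite -rotor_logE /rotor_log count_map count_filter /traverse_count.
rewrite -(count_iota t (fun s => edge_at O c s == e)).
apply: eq_count => s /=; have [ce|ne] := eqVneq (chip s) (etail e).
  by rewrite andbT /edge_at ce.
rewrite andbF; apply: contraNF ne => /eqP <-.
by rewrite /edge_at etail_rotor_at.
Qed.

Lemma reach_countE t v :
  reach_count O c t v = \sum_(e : edge D | ehead e == v) traverse_count O c t e.
Proof.
rewrite /reach_count -sum1_card.
rewrite (partition_big (fun s : 'I_t => edge_at O c s) (fun e => ehead e == v)).
  apply: eq_bigr => e /eqP he; rewrite /traverse_count -sum1_card.
  apply: eq_bigl => s; rewrite !inE chip_atS.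
  by case: (eqVneq (edge_at O c s) e) => [->|]; rewrite ?he ?eqxx ?andbF.
by move=> s; rewrite inE chip_atS.
Qed.

(** Both sides count the times from 0 to [t] with the chip at [v]. *)
Lemma reach_count_visits t v :
  reach_count O c t v + (chip 0 == v) = visits t v + (chip t == v).
Proof.
rewrite /reach_count -(count_iota t (fun s => chip s.+1 == v)).
elim: t => [|t IH] //.
by rewrite -addn1 iotaD count_cat /= addn0 addnAC IH addn1 visitsS.
Qed.

Lemma traverse_count_eq t e q :
  visits t (etail e) = q * outdeg D (etail e) -> traverse_count O c t e = q.
Proof.
move=> ve; rewrite traverse_countE ve -card_porbit_rotor count_traject_mul //.
by rewrite mem_porbit_rotor.
Qed.

(** The rotor log at the tail of [e] is a prefix of [q] full turns, in which [e] occurs [q]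
    times. *)
Lemma traverse_count_le t e q :
  visits t (etail e) <= q * outdeg D (etail e) -> traverse_count O c t e <= q.
Proof.
move=> /subnKC ve; have := @count_traject_mul _ (nxt O) (rho (etail e)) q e.
rewrite mem_porbit_rotor eqxx card_porbit_rotor => /(_ isT) <-.
by rewrite traverse_countE -ve traject_add count_cat leq_addr.
Qed.

(* A full turn ends with the edge that the rotor initially pointed to. *)
Lemma traverse_count_rotor_lt t v q :
  visits t v < q * outdeg D v -> traverse_count O c t (rho v) < q.
Proof.
move=> lt_v; have := @count_traject_mul _ (nxt O) (rho v) q (rho v).
rewrite mem_porbit_rotor rho_ok eqxx card_porbit_rotor => /(_ isT) <-.
have qd_gt0 := leq_ltn_trans (leq0n _) lt_v.
have last_rho : iter (q * outdeg D v).-1 (nxt O) (nxt O (rho v)) = rho v.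
  by rewrite -iterSr prednK // iter_mul_id // -card_porbit_rotor iter_porbit.
rewrite traverse_countE rho_ok -(prednK qd_gt0) trajectSr last_rho.
rewrite -cats1 count_cat /= eqxx addn1 ltnS.
rewrite -(prednK qd_gt0) ltnS in lt_v.
by rewrite -(subnKC lt_v) traject_add count_cat leq_addr.
Qed.

Lemma visits_le (b : 'I_n -> nat) t :
  (forall s, s < t -> visits s (chip s) < b (chip s)) ->
  forall v, visits t v <= b v.
Proof.
elim: t => // t IH lt_b v; rewrite visitsS.
have [<-|_] := eqVneq (chip t) v; first by rewrite addn1 lt_b.
by rewrite addn0 IH // => s st; rewrite lt_b // ltnW.
Qed.

(** Otherwise no vertex would exceed its bound during the first [S.+1] departures, although the
    bounds add up to [S] only. *)
Lemma visits_saturate (b : 'I_n -> nat) :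
  exists t, b (chip t) <= visits t (chip t).
Proof.
pose S := \sum_v b v.
have [/existsP[t bt]|] :=
  boolP [exists t : 'I_S.+1, b (chip t) <= visits t (chip t)].
  by exists t.
rewrite negb_exists => /forallP lt_b.
suff: S.+1 <= S by rewrite ltnn.
rewrite -{1}(sum_visits S.+1); apply: leq_sum => v _.
by apply: visits_le => s sS; have := lt_b (Ordinal sS); rewrite -ltnNge.
Qed.

Lemma iter_rotor_step_id t :
  chip t = chip 0 -> (forall v, outdeg D v %| visits t v) ->
  iter t (rotor_step O) c = c.
Proof.
move=> ct dv; rewrite [LHS]surjective_pairing [RHS]surjective_pairing.
congr (_, _) => //; apply/ffunP => v.
rewrite -[LHS]/(rotor_at O c t v) rotor_atE.
have /dvdnP[q ->] := dv v.
by rewrite iter_mul_id // -card_porbit_rotor iter_porbit.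
Qed.

Lemma return_outdeg_dvd t v :
  iter t (rotor_step O) c = c -> outdeg D v %| visits t v.
Proof.
move=> ct; rewrite -card_porbit_rotor; apply: iter_porbit_dvd.
by rewrite -rotor_atE /rotor_at ct.
Qed.

(** On a return, arrivals equal departures at every vertex, and each edge is traversed once per full
    turn of the rotor at its tail. *)
Lemma return_balanced t :
  iter t (rotor_step O) c = c -> balanced D (fun v => visits t v %/ outdeg D v).
Proof.
move=> ct v; rewrite divnK ?return_outdeg_dvd //.
have : visits t v = reach_count O c t v.
  apply/eqP; rewrite -(eqn_add2r (chip 0 == v)) reach_count_visits.
  by rewrite /chip_at ct.
move=> ->; rewrite reach_countE; apply: eq_bigr => e _.
by apply: traverse_count_eq; rewrite divnK ?return_outdeg_dvd.
Qed.

Hypothesis sc : strongly_connected D.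

Lemma return_visits_ge t v :
  0 < t -> iter t (rotor_step O) c = c -> per sc v * outdeg D v <= visits t v.
Proof.
move=> t_gt0 ct; rewrite -leq_divRL ?outdeg_gt0 //.
have [u vu] : exists u, 0 < visits t u.
  exists (chip 0); case: t t_gt0 {ct} => // t _.
  by rewrite /visits /= eqxx.
apply: (@per_le_balanced _ _ sc (fun v => visits t v %/ outdeg D v) u).
  exact: return_balanced.
by rewrite divn_gt0 ?outdeg_gt0 // dvdn_leq // return_outdeg_dvd.
Qed.

End RotorWalk.

(** Following the rotors from [v] ends in a directed cycle, which by uniqueness is the one that
    carries the chip. *)
Lemma unicycle_iter (n : nat) (D : digraph n) (c : chip_config D) (v : 'I_n) :
  unicycle c -> exists k, iter k (fun u => ehead (c.2 u)) v = c.1.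
Proof.
move=> [rho_ok [C [_ uniqC] wC]]; set f := fun u => ehead (c.2 u).
have /trajectP[i lt_i fi] := looping_order f v.
set p := iter i f v in fi.
(* The trajectory of [v] comes back to [p], so a positive number of steps, [fingraph.order f v - i],
   leads from [p] to itself. *)
have cyc : fcycle f (fingraph.orbit f p).
  apply/(orbitPcycle 0 3); exists (fingraph.order f v - i).-1.
  by rewrite prednK ?subn_gt0 // -iterD subnK // ltnW.
have tK : map (@etail _ D) (map c.2 (fingraph.orbit f p)) = fingraph.orbit f p.
  by rewrite -map_comp map_id_in // => u _ /=; rewrite rho_ok.
have CE : C = [set e in map c.2 (fingraph.orbit f p)].
  apply: uniqC; split.
    exists (map c.2 (fingraph.orbit f p)); split=> //.
    - by rewrite /fingraph.orbit -orderSpred.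
    - rewrite cycle_map; apply: sub_cycle cyc => a b /eqP <- /=.
      by rewrite rho_ok.
    - by rewrite tK orbit_uniq.
  by apply/subsetP => e; rewrite inE => /mapP[u _ ->]; rewrite imset_f.
have : c.1 \in fingraph.orbit f p.
  case/imsetP: wC => e; rewrite CE inE => eC ->.
  by rewrite -tK map_f.
case/trajectP => j _ ->; exists (j + i).
by rewrite iterD.
Qed.

Theorem theorem2 (n : nat) (D : digraph n) (O : rotor_order D)
    (sc : strongly_connected D) (c : chip_config D) (uc : unicycle c) :
  exists T : nat,
    [/\ first_return O c T,
        forall v : 'I_n, reach_count O c T v = (per sc v * outdeg D v)%N,
        forall v : 'I_n, full_turns O c T v (per sc v),
        forall e : edge D, traverse_count O c T e = per sc (etail e)
      & T = (\sum_(v < n) per sc v * outdeg D v)%N].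
Proof.
have [rho_ok _] := uc.
pose b v := per sc v * outdeg D v.
case: (ex_minnP (visits_saturate O c b)) => T sat minT; exists T.
have vle v : visits O c T v <= b v.
  (* By minimality of [T], every earlier departure is from a vertex still below its bound. *)
  apply: visits_le => s sT; rewrite ltnNge.
  by apply: contraTN sT => /minT; rewrite -leqNgt.
have trle e : traverse_count O c T e <= per sc (etail e).
  by apply: traverse_count_le => //; apply: vle.
have inle v : reach_count O c T v <= b v.
  by rewrite (reach_countE O) /b per_balanced; apply: leq_sum => e _.
have cT : chip_at O c T = chip_at O c 0.
  (* Away from its start, the chip would have entered its present vertex once more than it left it,
     hence more than [b] times. *)
  apply/esym/eqP; have := reach_count_visits O c T (chip_at O c T).
  rewrite eqxx; case: eqP => // _; rewrite addn0 addn1 => inT.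
  by have := leq_trans (inle (chip_at O c T)) sat; rewrite inT ltnn.
have inE v : reach_count O c T v = visits O c T v.
  apply/eqP; rewrite -(eqn_add2r (chip_at O c 0 == v)) reach_count_visits.
  by rewrite cT.
(* Saturation propagates backwards along the rotors: if [v] is saturated then so
   are its in-edges, and an initial rotor is the last edge to be saturated. *)
have back v : visits O c T (ehead (c.2 v)) = b (ehead (c.2 v)) ->
    visits O c T v = b v.
  move=> sat_h; apply/eqP; rewrite eqn_leq vle leqNgt /=; apply/negP.
  move/(traverse_count_rotor_lt rho_ok) => lt_tr.
  have /eqP := sat_h; rewrite -inE reach_countE // /b per_balanced.
  rewrite eqn_leq => /andP[_]; rewrite leqNgt => /negP[].
  rewrite (bigD1 (c.2 v)) //= [ltnRHS](bigD1 (c.2 v)) //= rho_ok.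
  by rewrite -addSn leq_add // leq_sum.
have sat_all v : visits O c T v = b v.
  have [k] := unicycle_iter v uc.
  elim: k v => [|k IH] v; last by rewrite iterSr => /IH/back.
  move=> /= ->; apply/eqP; rewrite eqn_leq vle.
  by rewrite cT in sat.
have TE : T = \sum_(v < n) per sc v * outdeg D v.
  by rewrite -{1}(sum_visits O c T); apply: eq_bigr => v _; apply: sat_all.
split=> //.
- split.
  + rewrite lt0n; apply/eqP => T0; move: sat; rewrite T0 leqNgt => /negP[].
    by rewrite /b muln_gt0 per_gt0 (outdeg_gt0 O rho_ok).
  + apply: iter_rotor_step_id => // v.
    by rewrite sat_all dvdn_mull.
  + move=> t /andP[t_gt0 lt_tT] ct; move: lt_tT.
    (* Times are total numbers of departures, and any return needs at least [b v] of them at each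
       [v]. *)
    rewrite ltnNge {1}TE -[in X in _ <= X](sum_visits O c t) => /negP[].
    by apply: leq_sum => v _; apply: return_visits_ge.
- by move=> v; rewrite inE sat_all.
- move=> v; rewrite /full_turns rotor_logE sat_all traject_mul //.
  by rewrite -iterSr iterS -(card_porbit_rotor O rho_ok) iter_porbit.
- by move=> e; apply: traverse_count_eq => //; apply: sat_all.
Qed.
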